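(* Let $\alpha\in\mathbb{C}$ with $|\alpha|\le 1$ and $\alpha\notin\{-1,1\}$, and let $n\ge 3$ be an integer. Then the matrix $A_{\alpha,n}$ has $n$ different eigenvalues belonging to $(0,4)$. More precisely, for every $j\in\{1,\ldots,n\}$, $$g\left(\frac{(j-1)\pi}{n}\right)<\lambda_{\alpha,n,j}<g\left(\frac{j\pi}{n}\right).$$
   Context: For $\alpha\in\mathbb{C}$ and an integer $n\ge 3$, $A_{\alpha,n}$ is the $n\times n$ complex matrix with all main diagonal entries equal to $2$, all entries on the first subdiagonal and on the first superdiagonal equal to $-1$, the $(1,n)$ entry equal to $-\overline{\alpha}$, the $(n,1)$ entry equal to $-\alpha$, and all other entries $0$. It is Hermitian, and its (real) eigenvalues, counted with multiplicity, are enumerated in ascending order: $\lambda_{\alpha,n,1}\le\lambda_{\alpha,n,2}\le\cdots\le\lambda_{\alpha,n,n}$. The function $g$ is $g(x)=4\sin^2(x/2)$. *)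

(* Defs.v *)
From mathcomp Require Import all_boot all_order all_algebra.
From mathcomp Require Import reals trigo.
From mathcomp.real_closed Require Import complex.

Set Implicit Arguments.
Unset Strict Implicit.
Unset Printing Implicit Defensive.
Import Order.TTheory GRing.Theory Num.Theory.

Local Open Scope ring_scope.
Local Open Scope complex_scope.

(* Row and column indices are shifted by one: the (1, n) entry is (0, n.-1). *)
Definition Amx (R : realType) (alpha : R[i]) (n : nat) : 'M[R[i]]_n :=
  \matrix_(i, j)
    if (i == j :> nat) then 2
    else if (i == j.+1 :> nat) || (j == i.+1 :> nat) then - 1
    else if (i == 0 :> nat) && (j == n.-1 :> nat) then - Num.conj alpha
    else if (i == n.-1 :> nat) && (j == 0 :> nat) then - alpha
    else 0.

Definition char_roots (R : realType) (n : nat) (A : 'M[R[i]]_n) : seq R[i] :=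
  sval (closed_field_poly_normal (char_poly A)).

(* Eigenvalues with algebraic multiplicity, in ascending order. Taking real
   parts only changes their type when A is Hermitian, see [eigvals_hermE]. *)
Definition eigvals (R : realType) (n : nat) (A : 'M[R[i]]_n) : seq R :=
  sort <=%R [seq complex.Re z | z <- char_roots A].

(* 1-indexed, for 1 <= j <= n. *)
Definition lambda (R : realType) (alpha : R[i]) (n j : nat) : R :=
  nth 0 (eigvals (Amx alpha n)) j.-1.

Definition g (R : realType) (x : R) : R := 4 * sin (x / 2) ^+ 2.

Lemma char_rootsE (R : realType) (n : nat) (A : 'M[R[i]]_n) :
  char_poly A = \prod_(z <- char_roots A) ('X - z%:P).
Proof.
rewrite /char_roots; case: closed_field_poly_normal => r /= {1}->.
by rewrite (monicP (char_poly_monic A)) scale1r.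
Qed.

Lemma size_eigvals (R : realType) (n : nat) (A : 'M[R[i]]_n) :
  size (eigvals A) = n.
Proof.
rewrite size_sort size_map; apply: succn_inj.
by rewrite -(size_char_poly A) char_rootsE size_prod_XsubC.
Qed.

Lemma eigvals_sorted (R : realType) (n : nat) (A : 'M[R[i]]_n) :
  sorted <=%R (eigvals A).
Proof. exact: sort_le_sorted. Qed.

Lemma herm_eigenvalue_real (R : realType) (n : nat) (A : 'M[R[i]]_n) (z : R[i]) :
  A \is hermsymmx -> eigenvalue A z -> z \is Num.real.
Proof.
move=> /is_hermitianmxP; rewrite expr0 scale1r => hA /eigenvalueP[v vA v0].
set w := v *m (map_mx Num.conj v)^T.
have wE : w 0 0 = \sum_k `|v 0 k| ^+ 2.
  by rewrite mxE; apply: eq_bigr => k _; rewrite !mxE -normCK.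
have w_neq0 : w 0 0 != 0.
  rewrite wE psumr_neq0 => [|k _]; last by rewrite exprn_ge0.
  have /rV0Pn[k vk] := v0; apply/hasP; exists k; first exact: mem_index_enum.
  by rewrite /= exprn_gt0 ?normr_gt0.
have e1 : v *m A *m (map_mx Num.conj v)^T = z *: w by rewrite vA -scalemxAl.
have e2 : v *m A *m (map_mx Num.conj v)^T = Num.conj z *: w.
  rewrite -mulmxA [in LHS]hA -map_trmx -trmx_mul -map_mxM vA /=.
  by rewrite map_mxZ linearZ /= scalemxAr.
have := congr1 (fun M : 'M_1 => M 0 0) (etrans (esym e1) e2).
move: (w) w_neq0 => {wE e1 e2}u u_neq0; rewrite /= !mxE => /(mulIf u_neq0) zE.
by apply/CrealP.
Qed.

Lemma eigvals_hermE (R : realType) (n : nat) (A : 'M[R[i]]_n) :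
  A \is hermsymmx -> char_poly A = \prod_(x <- eigvals A) ('X - (x%:C)%:P).
Proof.
move=> hA; rewrite (perm_big _ (permEl (perm_sort _ _))) big_map char_rootsE.
apply: eq_big_seq => z zr; rewrite RRe_real //.
apply: (herm_eigenvalue_real hA).
by rewrite eigenvalue_root_char char_rootsE root_prod_XsubC.
Qed.

Lemma Amx_herm (R : realType) (alpha : R[i]) (n : nat) :
  (3 <= n)%N -> Amx alpha n \is hermsymmx.
Proof.
move=> n3; apply/is_hermitianmxP; rewrite expr0 scale1r.
apply/matrixP => i j; rewrite !mxE [in RHS]eq_sym [in RHS]orbC.
case: ifP => _; first by rewrite rmorph_nat.
case: ifP => _; first by rewrite rmorphN rmorph1.
rewrite [(j == 0 :> nat) && _]andbC [(j == n.-1 :> nat) && _]andbC.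
case: (boolP ((i == n.-1 :> nat) && (j == 0 :> nat))) => [/andP[/eqP-> _]|_].
  have -> : (n.-1 == 0) = false by case: (n) n3 => [|[]].
  by rewrite /= rmorphN /= conjCK.
by case: ifP => _; rewrite ?rmorphN /= ?conjCK ?rmorph0.
Qed.

(* Main.v *)
Require Import Defs.
From mathcomp Require Import all_boot all_order all_algebra.
From mathcomp Require Import reals trigo.
From mathcomp.real_closed Require Import complex polyrcf.
From mathcomp Require Import ring lra zify.
Import Order.TTheory GRing.Theory Num.Theory.
Local Open Scope ring_scope.
Local Open Scope complex_scope.

(** Put t = 2 - lambda. Away from its first and last coordinates, the equation
    v A = lambda v says that v satisfies v_(k-1) + v_(k+1) = t v_k, and the two
    corners of A turn the first and last coordinates into the boundary
    conditions v_(-1) = alpha v_(n-1) and v_n = conj(alpha) v_0. Let u be the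
    solution of the recurrence with u_0 = 0 and u_1 = 1. The solution
    v_k = u_(n-k) + conj(alpha) u_k satisfies the second boundary condition for
    every t, and the first one exactly when

      u_(n+1) - |alpha|^2 u_(n-1) - 2 Re alpha = 0.

    The left-hand side is a polynomial in lambda ([secular]), so each of its
    real roots is an eigenvalue; no determinant has to be expanded. That v is
    not zero follows from the Cassini identity for u, and this uses
    alpha <> 1, -1 ([chebU_eigenvalue]).

    If lambda = g(x) then t = 2 cos x, so sin(x) u_k = sin(k x). At a node
    x = j pi / n with 0 < j < n this gives u_(n+1) = - u_(n-1) = (-1)^j, and
    (-1)^j times the secular polynomial is 1 + |alpha|^2 - 2 (-1)^j Re alpha
    = |alpha - (-1)^j|^2 > 0. At the end nodes 0 and pi there is the extra
    nonnegative term n (1 - |alpha|^2). The secular polynomial thus alternates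
    in sign along the n + 1 nodes ([secular_node]), which yields one root in
    each of the n open intervals between consecutive g(j pi / n)
    ([secular_root_between]). These are n distinct eigenvalues of a matrix of
    size n, hence the whole spectrum ([eigvals_lt_sorted]), and the j-th in
    ascending order is the one in the j-th interval. *)

(** * Chebyshev polynomials of the second kind *)

(** With the classical notation this is U_(k-1)(t / 2). In this normalisation
    the recurrence starts from 0 and has integer coefficients, so t can be a
    real number, a complex number or a polynomial in lambda, and ring morphisms
    pass from one to another. *)
Fixpoint chebU (R : comNzRingType) (t : R) (k : nat) : R :=
  if k is k1.+1 then
    if k1 is k2.+1 then t * chebU R t k1 - chebU R t k2 else 1
  else 0.
Arguments chebU {R} t k.

Lemma chebUSS (R : comNzRingType) (t : R) k :
  chebU t k.+2 = t * chebU t k.+1 - chebU t k.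
Proof. by []. Qed.

Lemma rmorph_chebU (R S : comNzRingType) (f : {rmorphism R -> S}) (t : R) k :
  f (chebU t k) = chebU (f t) k.
Proof.
suff [] : f (chebU t k) = chebU (f t) k /\
          f (chebU t k.+1) = chebU (f t) k.+1 by [].
elim: k => [|k [IH0 IH1]]; first by rewrite rmorph0 rmorph1.
by rewrite !chebUSS rmorphB rmorphM IH0 IH1.
Qed.

(** The left-hand side is the determinant of two consecutive states of a
    recurrence whose transfer matrix has determinant 1. *)
Lemma chebU_cassini (R : comNzRingType) (t : R) k :
  chebU t k.+1 ^+ 2 - chebU t k.+2 * chebU t k = 1.
Proof.
elim: k => [|k IH]; first by rewrite /=; ring.
by rewrite -{}[RHS]IH (chebUSS _ _ k.+1) (chebUSS _ _ k); ring.
Qed.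

(** The two identities are proved together: the addition formulas carry the
    pair from k to k + 1. The second one still determines the value of chebU
    where sin x = 0. *)
Lemma chebU_cos (R : realType) (x : R) k :
  sin x * chebU (2 * cos x) k = sin (k%:R * x) /\
  chebU (2 * cos x) k.+1 = cos (k%:R * x) + cos x * chebU (2 * cos x) k.
Proof.
elim: k => [|k [IHs IHc]].
  by rewrite /= mul0r sin0 cos0 !mulr0 addr0.
have E : k.+1%:R * x = k%:R * x + x by rewrite -natr1 mulrDl mul1r.
split; first by rewrite IHc E sinD -IHs; ring.
rewrite chebUSS E cosD -IHs IHc.
by have := sin2cos2 x; rewrite expr2 => h; ring: h.
Qed.

(** Used for t = 2 and t = -2, the values of 2 cos x that cannot be handled
    through sin (k x) / sin x. *)
Lemma chebU_pm2 (R : comNzRingType) (c : R) k :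
  c ^+ 2 = 1 -> chebU (2 * c) k.+1 = k.+1%:R * c ^+ k.
Proof.
move=> c2.
suff [] : chebU (2 * c) k.+1 = k.+1%:R * c ^+ k /\
          c * chebU (2 * c) k = k%:R * c ^+ k by [].
elim: k => [|k [IH1 IH0]]; first by rewrite /= !mulr0 mul0r mulr1.
split; last by rewrite IH1 exprS; ring.
have IH0' : chebU (2 * c) k = c * (k%:R * c ^+ k).
  by rewrite -IH0 mulrA -expr2 c2 mul1r.
by rewrite chebUSS IH1 IH0' -!natr1 exprS; ring.
Qed.

(** * The secular polynomial and its signs at the nodes *)

(** For n >= 3 this is, up to sign, the characteristic polynomial of
    [Amx alpha n]; only the fact that its roots are eigenvalues is used. *)
Definition secular (R : realType) (alpha : R[i]) (n : nat) : {poly R} :=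
  chebU (2%:P - 'X) n.+1
  - (complex.Re alpha ^+ 2 + complex.Im alpha ^+ 2) *: chebU (2%:P - 'X) n.-1
  - (2 * complex.Re alpha)%:P.

Lemma horner_secular (R : realType) (alpha : R[i]) n (x : R) :
  (secular R alpha n).[x] =
    chebU (2 - x) n.+1
    - (complex.Re alpha ^+ 2 + complex.Im alpha ^+ 2) * chebU (2 - x) n.-1
    - 2 * complex.Re alpha.
Proof.
have E k : (chebU (2%:P - 'X) k).[x] = chebU (2 - x) k.
  by rewrite -[LHS]/(horner_eval x _) rmorph_chebU /= /horner_eval !hornerE.
by rewrite /secular !hornerE !E.
Qed.

Lemma gE (R : realType) (x : R) : g x = 2 - 2 * cos x.
Proof.
have -> : cos x = cos (x / 2 *+ 2) by rewrite -mulr_natr divfK ?pnatr_eq0.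
by rewrite cos_mulr2n cos2sin2 /g; ring.
Qed.

Lemma disk_Re_Im (R : realType) (alpha : R[i]) :
  `|alpha| <= 1 -> complex.Re alpha ^+ 2 + complex.Im alpha ^+ 2 <= 1.
Proof.
by rewrite normc_def -[1]/(1%:C) lecR -{1}sqrtr1 ler_sqrt.
Qed.

(** The points x with sin (n x) = 0 are the multiples of pi / n, and cos (n x)
    is the sign (-1)^j there. With e for this sign and w = cos x * u_n, the
    quantity is |alpha - e|^2 + e w (1 - |alpha|^2). Either sin x <> 0 and w = 0,
    or cos x = 1 or -1 and e w = n. *)
Lemma secular_node (R : realType) (alpha : R[i]) n (x : R) :
  `|alpha| <= 1 -> alpha <> 1 -> alpha <> - 1 -> (0 < n)%N ->
  sin (n%:R * x) = 0 -> 0 < cos (n%:R * x) * (secular R alpha n).[g x].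
Proof.
case: n => // m /disk_Re_Im a1 an1 anN1 _ s0.
rewrite horner_secular gE subKr [_.-1]/=.
set e := cos (m.+1%:R * x); set c := cos x.
have e2 : e ^+ 2 = 1 by rewrite /e cos2sin2 s0 expr0n subr0.
have [us uc] := chebU_cos R x m.+1.
rewrite -/e -/c s0 in us uc.
have um : chebU (2 * c) m = c * chebU (2 * c) m.+1 - e.
  by move: uc; rewrite chebUSS; lra.
have ge0 : 0 <= e * (c * chebU (2 * c) m.+1).
  have [sx|sx] := eqVneq (sin x) 0; last first.
    by move/eqP: us; rewrite mulf_eq0 (negPf sx) /= => /eqP->; rewrite !mulr0.
  have c2 : c ^+ 2 = 1 by rewrite /c cos2sin2 sx expr0n subr0.
  have -> : e = c ^+ m.+1.
    by move: uc; rewrite !chebU_pm2 // !exprS -!natr1; lra.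
  rewrite chebU_pm2 // (mulrCA c) -exprS mulrCA -exprD addnn -mul2n exprM c2 expr1n mulr1.
  exact: ler0n.
(* The point e is 1 or -1, and alpha is neither. *)
have pos : 0 < (complex.Re alpha - e) ^+ 2 + complex.Im alpha ^+ 2.
  rewrite lt_neqAle addr_ge0 ?sqr_ge0 // andbT eq_sym paddr_eq0 ?sqr_ge0 //.
  rewrite !sqrf_eq0 subr_eq0; apply/negP => /andP[/eqP aR /eqP aI].
  move/eqP: e2; rewrite sqrf_eq1 => /orP[] /eqP e1; [apply: an1|apply: anN1];
    by rewrite [alpha]complexE aR aI e1 mulr0 addr0 ?rmorphN.
rewrite uc um; move: ge0 pos; set w := c * _ => ge0 pos.
set A := _ + _ in a1 *; set q := e * _.
have -> : q = (complex.Re alpha - e) ^+ 2 + complex.Im alpha ^+ 2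
    + e * w * (1 - A) by rewrite /q /A; ring: e2.
by apply: ltr_wpDr => //; rewrite mulr_ge0 // subr_ge0.
Qed.

(** * Eigenvectors *)

(** As a sum of indicators of the nonzero diagonals and corners, each row-vector
    product splits into sums with at most one nonzero term. With at least three rows the
    corners do not meet the subdiagonal and the superdiagonal. *)
Lemma AmxE (R : realType) (alpha : R[i]) m (i j : 'I_m.+1) : (2 <= m)%N ->
  Amx alpha m.+1 i j = 2 * (i == j :> nat)%:R - (i == j.+1 :> nat)%:R
    - (i.+1 == j :> nat)%:R
    - (j == m :> nat)%:R * Num.conj alpha * (i == 0 :> nat)%:R
    - (j == 0 :> nat)%:R * alpha * (i == m :> nat)%:R.
Proof.
move=> m2; rewrite mxE /= (eq_sym (j : nat) i.+1).
have [e1|n1] := eqVneq (i : nat) j.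
  have -> : (i == j.+1 :> nat) = false by lia.
  have -> : (i.+1 == j :> nat) = false by lia.
  have [e2|n2] := eqVneq (i : nat) 0; have [e3|n3] := eqVneq (i : nat) m;
  have [e4|n4] := eqVneq (j : nat) 0; have [e5|n5] := eqVneq (j : nat) m;
    try (exfalso; lia); by rewrite /=; ring.
have [e2|n2] := eqVneq (i : nat) j.+1; have [e3|n3] := eqVneq i.+1 (j : nat);
have [e4|n4] := eqVneq (i : nat) 0; have [e5|n5] := eqVneq (i : nat) m;
have [e6|n6] := eqVneq (j : nat) 0; have [e7|n7] := eqVneq (j : nat) m;
    try (exfalso; lia); by rewrite /=; ring.
Qed.

Lemma sum_ord_pick (R : pzRingType) n (F : nat -> R) (c : nat) :
  \sum_(k < n) F k * (k == c :> nat)%:R = if (c < n)%N then F c else 0.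
Proof.
case: ltnP => cn.
  rewrite (bigD1 (Ordinal cn)) //= eqxx mulr1 big1 ?addr0 // => k.
  by rewrite -val_eqE /= => /negPf->; rewrite mulr0.
rewrite big1 // => k _; have -> : (k == c :> nat) = false.
  by apply/negP => /eqP kc; move: (ltn_ord k); rewrite kc ltnNge cn.
by rewrite mulr0.
Qed.

Lemma row_mul_Amx (R : realType) (alpha : R[i]) m (w : nat -> R[i]) (j : 'I_m.+1) :
  (2 <= m)%N ->
  ((\row_(i < m.+1) w i) *m Amx alpha m.+1) 0 j =
    2 * w j - (if j == m :> nat then Num.conj alpha * w 0 else w j.+1)
      - (if j == 0 :> nat then alpha * w m else w j.-1).
Proof.
move=> m2; rewrite mxE.
under eq_bigr => k _.
  rewrite mxE AmxE // (_ : _ * _ = 2 * (w k * (k == j :> nat)%:R)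
    - w k * (k == j.+1 :> nat)%:R - w k * (k.+1 == j :> nat)%:R
    - (j == m :> nat)%:R * Num.conj alpha * (w k * (k == 0 :> nat)%:R)
    - (j == 0 :> nat)%:R * alpha * (w k * (k == m :> nat)%:R)); last by ring.
  over.
rewrite !sumrB -!mulr_sumr !sum_ord_pick ltn_ord ltnSn ltnS.
have -> : \sum_(k < m.+1) w k * (k.+1 == j :> nat)%:R
    = if j == 0 :> nat then 0 else w j.-1.
  have := ltn_ord j; case: (nat_of_ord j) => [|i] im /=.
    by rewrite big1 // => k _; rewrite mulr0.
  by under eq_bigr => k _ do rewrite eqSS; rewrite sum_ord_pick ltnW.
have := ltn_ord j; rewrite ltnS => jm.
have [jE|jn] := eqVneq (j : nat) m; have [j0|j1] := eqVneq (j : nat) 0.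
- by exfalso; lia.
- by rewrite jE ltnn /=; ring.
- by rewrite j0 (leq_trans _ m2) //=; ring.
- by rewrite ltn_neqAle jn jm /=; ring.
Qed.

(** The eigenvector is v_k = u_(n-k) + conj(alpha) u_k with n = m + 1. If it
    were zero, its first coordinate would give u_n = 0, hence
    u_(n+1) = - u_(n-1), and the Cassini identity would give u_(n-1)^2 = 1; its
    last coordinate 1 + conj(alpha) u_(n-1) would then force alpha^2 = 1. *)
Lemma chebU_eigenvalue (R : realType) (alpha z : R[i]) m :
  (2 <= m)%N -> alpha <> 1 -> alpha <> - 1 ->
  chebU (2 - z) m.+2 =
    alpha * Num.conj alpha * chebU (2 - z) m + (alpha + Num.conj alpha) ->
  eigenvalue (Amx alpha m.+1) z.
Proof.
move=> m2 an1 anN1; set t := 2 - z => ut.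
pose w k := chebU t (m.+1 - k) + Num.conj alpha * chebU t k.
apply/eigenvalueP; exists (\row_(i < m.+1) w i).
  apply/rowP => j; rewrite row_mul_Amx // !mxE.
  transitivity (2 * w j - t * w j); last by rewrite /t; ring.
  suff -> : t * w j = (if j == m :> nat then Num.conj alpha * w 0 else w j.+1)
      + (if j == 0 :> nat then alpha * w m else w j.-1) by ring.
  have := ltn_ord j; rewrite ltnS; move: (nat_of_ord j) => k km.
  have [kE|kn] := eqVneq k m.
    move: m2; rewrite kE /w subSnn subn0; case: (m) => [//|[//|p] _].
    have -> : (p.+3 - p.+2.-1 = 2)%N by lia.
    by rewrite !chebUSS /=; ring.
  have [k0|k1] := eqVneq k 0.
    move: ut; rewrite k0 /w subn0 subSnn subn1 chebUSS => ut.
    have -> : t * (chebU t m.+1 + Num.conj alpha * chebU t 0)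
      = chebU t m + (t * chebU t m.+1 - chebU t m) by rewrite /=; ring.
    by rewrite ut /=; ring.
  (* Interior coordinates: both halves of w satisfy the recurrence. *)
  case: k km kn k1 => // k km kn _.
  have [p mE] : exists p, m = (k + p).+2 by exists (m - k.+2)%N; lia.
  rewrite /w mE [k.+1.-1]/=.
  have -> : ((k + p).+3 - k.+1 = p.+2)%N by lia.
  have -> : ((k + p).+3 - k.+2 = p.+1)%N by lia.
  have -> : ((k + p).+3 - k = p.+3)%N by lia.
  by rewrite (chebUSS _ _ p.+1) (chebUSS _ _ k); ring.
apply/eqP => /rowP w0.
have um1 : chebU t m.+1 = 0.
  by have := w0 ord0; rewrite !mxE /w subn0 /= mulr0 addr0.
have um : Num.conj alpha * chebU t m = - 1.
  have /eqP := w0 ord_max; rewrite !mxE /w subSnn addrC addr_eq0.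
  by move/eqP.
have := chebU_cassini _ t m; rewrite chebUSS um1 => um2.
have : Num.conj alpha ^+ 2 = 1.
  have -> : Num.conj alpha ^+ 2 = Num.conj alpha ^+ 2 *
    (0 ^+ 2 - (t * 0 - chebU t m) * chebU t m) by rewrite um2 mulr1.
  transitivity ((Num.conj alpha * chebU t m) ^+ 2); first by ring.
  by rewrite um; ring.
rewrite -rmorphXn /= => /(congr1 Num.conj); rewrite conjCK rmorph1 => /eqP.
by rewrite sqrf_eq1 => /orP[] /eqP.
Qed.

Lemma secular_eigenvalue (R : realType) (alpha : R[i]) n (x : R) :
  (3 <= n)%N -> alpha <> 1 -> alpha <> - 1 ->
  root (secular R alpha n) x -> eigenvalue (Amx alpha n) x%:C.
Proof.
case: n => // m m2 an1 anN1 /rootP; rewrite horner_secular [m.+1.-1]/= => px0.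
apply: chebU_eigenvalue => //.
have -> : 2 - x%:C = (2 - x)%:C by rewrite rmorphB rmorph_nat.
rewrite -!(rmorph_chebU _ _ (real_complex R)).
have -> : alpha * Num.conj alpha
    = (complex.Re alpha ^+ 2 + complex.Im alpha ^+ 2)%:C.
  by rewrite -normCK normc_def -rmorphXn sqr_sqrtr // addr_ge0 ?sqr_ge0.
have -> : alpha + Num.conj alpha = (2 * complex.Re alpha)%:C.
  by case: (alpha) => a b; rewrite /Num.conj /=; simpc; rewrite mulr_natl mulr2n.
rewrite -rmorphM -rmorphD; congr (_%:C); lra.
Qed.

(** * One eigenvalue between any two consecutive nodes *)

Lemma le_g_node (R : realType) n j : (j < n)%N ->
  g (j%:R * pi / n%:R : R) <= g (j.+1%:R * pi / n%:R).
Proof.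
move=> jn; have n0 : 0 < n%:R :> R by rewrite ltr0n (leq_ltn_trans _ jn).
have node k : (k <= n)%N -> (k%:R * pi / n%:R : R) \in `[0, pi].
  move=> kn; rewrite in_itv /= divr_ge0 ?mulr_ge0 ?ler0n ?pi_ge0 //=.
  by rewrite ler_pdivrMr // mulrC ler_pM2l ?pi_gt0 // ler_nat.
rewrite !gE lerD2l lerN2 ler_pM2l // ltW // ltr_cos ?node ?(ltnW jn) //.
by rewrite -!mulrA ltr_pM2r ?ltr_nat // divr_gt0 ?pi_gt0.
Qed.

Lemma secular_root_between (R : realType) (alpha : R[i]) n j :
  `|alpha| <= 1 -> alpha <> 1 -> alpha <> - 1 -> (j < n)%N ->
  exists2 x, g (j%:R * pi / n%:R) < x < g (j.+1%:R * pi / n%:R)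
    & root (secular R alpha n) x.
Proof.
move=> a1 an1 anN1 jn; have n0 : (0 < n)%N by rewrite (leq_ltn_trans _ jn).
have nodeE k : n%:R * (k%:R * pi / n%:R) = pi *+ k :> R.
  by rewrite mulrC divfK ?pnatr_eq0 -?lt0n // mulr_natl.
have sinE k : sin (pi *+ k : R) = 0.
  elim: k => [|k IH]; first exact: sin0.
  by rewrite mulrSr sinDpi IH oppr0.
have node k := @secular_node R alpha n (k%:R * pi / n%:R) a1 an1 anN1 n0.
have := node j; have := node j.+1; rewrite !nodeE !sinE mulrSr cosDpi.
set c := cos _; set p := _.[_]; set q := _.[_] => /(_ erefl) cp /(_ erefl) cq.
have [|x] := @poly_ivtoo _ (secular R alpha n) _ _ (le_g_node R n j jn).
  (* c and - c are the signs (-1)^j and (-1)^(j+1) at the two nodes. *)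
  rewrite -/p -/q -(@pmulr_rlt0 _ (c ^+ 2)).
    by have := mulr_gt0 cp cq; nra.
  by rewrite exprn_even_gt0 //=; apply: contraTneq cq => ->; rewrite mul0r ltxx.
by rewrite in_itv /=; exists x.
Qed.

(** There are only n eigenvalues with multiplicity, so n distinct ones exhaust
    the list, and a strictly increasing list is determined by its elements. *)
Lemma eigvals_lt_sorted (R : realType) n (A : 'M[R[i]]_n) (s : seq R) :
  sorted <%R s -> size s = n -> {in s, forall x, eigenvalue A x%:C} ->
  eigvals A = s.
Proof.
move=> ss sn sA.
have s_sub : {subset s <= eigvals A}.
  move=> x /sA; rewrite eigenvalue_root_char char_rootsE root_prod_XsubC => xr.
  by rewrite mem_sort; apply/mapP; exists x%:C.
have ns : (size (eigvals A) <= size s)%N by rewrite size_eigvals sn.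
have us := lt_sorted_uniq ss.
apply: lt_sorted_eq => //.
  by rewrite lt_sorted_uniq_le eigvals_sorted (leq_size_uniq us).
by move=> x; rewrite (uniq_min_size us s_sub ns).2.
Qed.

Theorem theorem1 (R : realType) (alpha : R[i]) (n : nat)
    (alpha_le1 : `|alpha| <= 1) (alpha_neq1 : alpha <> 1)
    (alpha_neqN1 : alpha <> - 1) (n_ge3 : (3 <= n)%N) :
  (exists s : n.-tuple R, uniq s /\
     forall x : R, x \in s -> 0 < x < 4 /\ eigenvalue (Amx alpha n) x%:C) /\
  (forall j : nat, (1 <= j <= n)%N ->
     g ((j%:R - 1) * pi / n%:R) < lambda alpha n j < g (j%:R * pi / n%:R)).
Proof.
have ex_root (j : 'I_n) := secular_root_between R alpha n j alpha_le1 alpha_neq1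
  alpha_neqN1 (ltn_ord j).
have [r r_itv r_root] := fin_all_exists2 ex_root.
pose s := [tuple r j | j < n].
have nth_s (k : 'I_n) : nth 0 s k = r k by rewrite -tnth_nth tnth_mktuple.
have s_sorted : sorted <%R s.
  apply/(sortedP 0) => i; rewrite size_tuple => i1n.
  have /= -> := nth_s (Ordinal (ltnW i1n)); have /= -> := nth_s (Ordinal i1n).
  have /andP[_ lti] := r_itv (Ordinal (ltnW i1n)).
  by have /andP[+ _] := r_itv (Ordinal i1n); exact: lt_trans.
have s_eig : {in s, forall x, eigenvalue (Amx alpha n) x%:C}.
  by move=> x /mapP[j _ ->]; exact: secular_eigenvalue.
split.
  exists s; split => [|x xs]; first exact: lt_sorted_uniq s_sorted.
  split; last exact: s_eig.
  have /mapP[j _ ->] := xs; have /andP[gr rg] := r_itv j.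
  apply/andP; split.
    by apply: le_lt_trans gr; rewrite mulr_ge0 ?sqr_ge0.
  apply: lt_le_trans rg _; rewrite gE.
  by have := cos_geN1 (j.+1%:R * pi / n%:R : R); lra.
move=> [//|j] /= jn; rewrite /lambda (eigvals_lt_sorted _ _ _ s) ?size_tuple //.
by have := r_itv (Ordinal jn); rewrite -nth_s /= -natr1 addrK.
Qed.
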